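(* Let $n\geq 0$ and let $x_1,\dots,x_n\in 2^\omega$ be distinct points of the Cantor space. Then the pointwise stabiliser $(\mathrm{Homeo}\,2^\omega)_{(x_1,\dots,x_n)}=\{g\in\mathrm{Homeo}\,2^\omega: g(x_i)=x_i\ \forall i\in[n]\}$ has ample generics.
   Context: $\mathrm{Homeo}\,2^\omega$ is the group of homeomorphisms of the Cantor space, with its standard Polish topology (the compact-open topology, equivalently the topology of pointwise convergence of its action on the clopen subsets of $2^\omega$); the stabiliser carries the subspace topology. For a topological group $G$ and $m\in\mathbb{N}$, $G$ acts on $G^m$ by diagonal conjugation $(h_1,\dots,h_m)^g=(g^{-1}h_1g,\dots,g^{-1}h_mg)$; a tuple is generic if its orbit is comeagre in $G^m$; $G$ has ample generics if it has generic $m$-tuples for all $m\in\mathbb{N}$. $[n]=\{1,\dots,n\}$. *)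

(* Defs.v *)
From HB Require Import structures.
From mathcomp Require Import all_boot all_order all_algebra.
From mathcomp Require Import all_classical all_reals topology cantor.
Set Implicit Arguments. Unset Strict Implicit. Unset Printing Implicit Defensive.
Local Open Scope classical_set_scope.

Definition Cantor := cantor_space.

Record homeo := Homeo {
  hfun : Cantor -> Cantor;
  hinv : Cantor -> Cantor;
  hfun_cont : continuous hfun;
  hinv_cont : continuous hinv;
  hfunK : cancel hfun hinv;
  hinvK : cancel hinv hfun }.

Definition stab (n : nat) (x : 'I_n -> Cantor) : set homeo :=
  [set g | forall i, hfun g (x i) = x i].

Definition tuples (n : nat) (x : 'I_n -> Cantor) (m : nat) : set ('I_m -> homeo) :=
  [set t | forall j, stab x (t j)].

(* Basic open neighbourhood of a tuple t in G^m for the product of the topology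
   of pointwise convergence of the action on clopen subsets (restricted to the
   stabiliser): all tuples s in G^m with s_j(C) = t_j(C) for each clopen cs_i. *)
Definition basic_nbhd n (x : 'I_n -> Cantor) m (t : 'I_m -> homeo)
    k (cs : 'I_k -> set Cantor) : set ('I_m -> homeo) :=
  [set s | @tuples n x m s /\
     forall j i, hfun (s j) @` cs i = hfun (t j) @` cs i].

Definition gopen n (x : 'I_n -> Cantor) m (U : set ('I_m -> homeo)) : Prop :=
  U `<=` @tuples n x m /\
  forall t, U t -> exists (k : nat) (cs : 'I_k -> set Cantor),
    (forall i, clopen (cs i)) /\ basic_nbhd x t cs `<=` U.

Definition gnowhere_dense n (x : 'I_n -> Cantor) m (A : set ('I_m -> homeo)) : Prop :=
  forall U, gopen x U -> U !=set0 ->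
    exists V, [/\ gopen x V, V !=set0, V `<=` U & V `&` A = set0].

Definition gmeagre n (x : 'I_n -> Cantor) m (A : set ('I_m -> homeo)) : Prop :=
  exists N : nat -> set ('I_m -> homeo),
    (forall k, gnowhere_dense x (N k)) /\ A `<=` \bigcup_k N k.

Definition gcomeagre n (x : 'I_n -> Cantor) m (A : set ('I_m -> homeo)) : Prop :=
  gmeagre x (@tuples n x m `\` A).

Definition conj_orbit n (x : 'I_n -> Cantor) m (t : 'I_m -> homeo)
    : set ('I_m -> homeo) :=
  [set s | exists g, stab x g /\
     forall j (y : Cantor), hfun (s j) y = hinv g (hfun (t j) (hfun g y))].

Definition generic_tuple n (x : 'I_n -> Cantor) m (t : 'I_m -> homeo) : Prop :=
  @tuples n x m t /\ gcomeagre x (conj_orbit x t).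

Definition ample_generics n (x : 'I_n -> Cantor) : Prop :=
  forall m : nat, exists t : 'I_m -> homeo, generic_tuple x t.

(* Main.v *)
(** A homeomorphism tuple seen through a finite clopen partition is a finite set
    with [m] surjective relations, in which the points [x i] give marked vertices
    with loops; finer partitions give maps that are surjective on vertices and on
    edges. Every such structure is covered by an unfolding: its vertices are
    origins, vertices remembering the direction of the free group that leads back to
    an origin and having a single neighbour in every other direction, and isolated
    loops around the [x i]. Since everything is determined when moving away from an
    origin, unfoldings are amalgamation bases. Hence comeagrely many tuples have
    arbitrarily fine partitions that are amalgamation bases and realise every
    extension of these; such tuples exist by a Baire category argument, and any two
    of them are conjugate by back-and-forth. *)
Require Import Defs.
From mathcomp Require Import all_boot.
From mathcomp Require Import all_classical topology cantor.
Set Implicit Arguments. Unset Strict Implicit. Unset Printing Implicit Defensive.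
Local Open Scope classical_set_scope.

(** * Cylinders and locally constant maps *)

Definition agree k (x y : Cantor) := forall i, i < k -> x i = y i.

Lemma agree_refl k x : agree k x x.
Proof. by []. Qed.
#[local] Hint Resolve agree_refl : core.

Lemma agree_sym k x y : agree k x y -> agree k y x.
Proof. by move=> h i ik; rewrite h. Qed.

Lemma agree_trans k x y z : agree k x y -> agree k y z -> agree k x z.
Proof. by move=> h h' i ik; rewrite h // h'. Qed.

Lemma agree_le k l x y : k <= l -> agree l x y -> agree k x y.
Proof. by move=> kl h i ik; apply/h/(leq_trans ik). Qed.

Lemma agree_eq (x y : Cantor) : (forall k, agree k x y) -> x = y.
Proof. by move=> h; apply/funext => i; apply: (h i.+1). Qed.

Lemma nbhs_agree k (x : Cantor) : nbhs x (agree k x).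
Proof.
elim: k => [|k IH].
  by apply: filterS filterT => y _ i.
have hk : nbhs x [set y : Cantor | y k = x k].
  have := @proj_continuous nat (fun=> bool) k x [set b | b = x k].
  by apply; rewrite nbhs_principalE; move=> b /= ->.
apply: filterS2 IH hk => y /= h e i; rewrite ltnS leq_eqVlt => /orP[/eqP->//|]; exact: h.
Qed.

(** The product topology is a supremum of topologies induced by coordinates, so convergence of the
    cylinder filter to [x] is checked on one coordinate at a time. *)
Lemma agree_nbhs (x : Cantor) (U : set Cantor) :
  nbhs x U -> exists k, agree k x `<=` U.
Proof.
pose F := filter_from [set: nat] (fun k => agree k x).
have FF : Filter F.
  apply: filter_from_filter; first by exists 0.
  move=> i j _ _; exists (maxn i j) => // y h.
  by split; apply: agree_le h; rewrite ?leq_maxl ?leq_maxr.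
have Fx : F --> x.
  apply/cvg_sup => i A /= [_ [[B _ <-] Bx sBA]].
  exists i.+1 => // y h; apply: sBA => /=.
  by move: Bx; rewrite /= /proj (h i).
by move=> /Fx [k _ h]; exists k.
Qed.

(** Uniform local constancy. For predicates it amounts to clopenness, by compactness of the Cantor
    space. *)
Definition loc T (u : Cantor -> T) :=
  exists k, forall x y, agree k x y -> u x = u y.

Lemma clopen_loc (C : set Cantor) : clopen C -> loc (fun z => `[< C z >]).
Proof.
move=> [oC cC].
have /compact_near_coveringP/(_ _ \oo
  (fun k z => forall y, agree k z y -> C z <-> C y)) := cantor_space_compact.
case=> [z _|k _ /(_ k (leqnn k)) h]; last first.
  by exists k => z y zy; apply/asbool_equiv_eq/h.
have [k hk] : exists k, forall y, agree k z y -> C z <-> C y.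
  have [Cz|nCz] := pselect (C z).
    have /agree_nbhs[k hk] : nbhs z C by apply: open_nbhs_nbhs.
    by exists k => y /hk.
  have /agree_nbhs[k hk] : nbhs z (~` C).
    by apply: open_nbhs_nbhs; split=> //; rewrite openC.
  by exists k => y /hk.
exists (agree k z, [set l | k <= l]).
  by split; [exact: nbhs_agree|exists k].
move=> [z' l] /= [zz' kl] y z'y; rewrite -(hk _ zz').
by apply: hk; apply: agree_trans zz' _; apply: agree_le z'y.
Qed.

Lemma loc_clopen (C : set Cantor) : loc C -> clopen C.
Proof.
have op (D : set Cantor) : loc D -> open D.
  move=> [k hk]; rewrite openE => z Dz; apply: filterS (nbhs_agree k z) => y h.
  by rewrite -(hk _ _ h).
move=> hC; split; first exact: op.
rewrite -openC; apply: op; case: hC => k hk; exists k => z y /hk.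
by rewrite /setC/= => ->.
Qed.

Lemma loc_comp T T' (u : Cantor -> T) (f : T -> T') : loc u -> loc (f \o u).
Proof. by case=> k hk; exists k => z y /hk /= ->. Qed.

Lemma loc_pair T T' (u : Cantor -> T) (v : Cantor -> T') :
  loc u -> loc v -> loc (fun z => (u z, v z)).
Proof.
move=> [k hk] [l hl]; exists (maxn k l) => z y h.
by congr pair; [apply: hk|apply: hl]; apply: agree_le h; rewrite ?leq_maxl ?leq_maxr.
Qed.

Lemma loc_ffun (I : finType) T (u : I -> Cantor -> T) :
  (forall i, loc (u i)) -> loc (fun z => [ffun i => u i z]).
Proof.
move=> /choice[k hk]; exists (\max_i k i) => z y h; apply/ffunP => i.
by rewrite !ffunE; apply: hk; apply: agree_le h; exact: leq_bigmax.
Qed.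

Definition lvl l (z : Cantor) : {ffun 'I_l -> bool} := [ffun i => z (val i)].

Lemma loc_lvl l : loc (lvl l).
Proof. by exists l => z y h; apply/ffunP => i; rewrite !ffunE; exact: (h i (ltn_ord i)). Qed.

Lemma lvl_agree l z y : lvl l z = lvl l y -> agree l z y.
Proof. by move=> /ffunP h i il; move: (h (Ordinal il)); rewrite !ffunE. Qed.

Definition ucont (f : Cantor -> Cantor) :=
  forall l, exists k, forall z y, agree k z y -> agree l (f z) (f y).

Lemma ucont_continuous f : ucont f -> continuous f.
Proof.
move=> hf z U /= /agree_nbhs[l hl]; have [k hk] := hf l.
by apply: filterS (nbhs_agree k z) => y /= /hk /hl.
Qed.

Lemma continuous_loc T (f : Cantor -> Cantor) (u : Cantor -> T) :
  continuous f -> loc u -> loc (u \o f).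
Proof.
move=> cf [l hl].
have h : loc (fun z => lvl l (f z)).
  apply: loc_ffun => i.
  have /clopen_loc[k hk] : clopen (f @^-1` [set z : Cantor | z (val i)]).
    have c : clopen [set z : Cantor | z (val i)].
      apply: loc_clopen; exists i.+1 => z y h.
      by have := h i (ltnSn i); rewrite /mkset /= => ->.
    by case: c => ? ?; split; [move/continuousP: cf|move/continuous_closedP: cf]; exact.
  by exists k => z y /hk; rewrite /preimage /mkset !asboolb.
by case: h => k hk; exists k => z y /hk /lvl_agree /hl.
Qed.

(** * Limits of relations *)

(** The sections [R k z] form a decreasing sequence of nonempty clopen sets. The last hypothesis
    makes their diameters tend to 0 uniformly in [z], so each intersection is one point, depending
    uniformly continuously on [z]. *)
Lemma limit_fun (R : nat -> Cantor -> Cantor -> Prop) :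
  (forall k z y, R k.+1 z y -> R k z y) ->
  (forall k z, exists y, R k z y) ->
  (forall k z, loc (R k z)) ->
  (forall l, exists k k', forall z z' y y',
     agree k' z z' -> R k z y -> R k z' y' -> agree l y y') ->
  exists f, (forall k z, R k z (f z)) /\ ucont f.
Proof.
move=> R1 R2 R3 /choice[K R4]; have {}R2 k z := cid (R2 k z).
have Rle k l z y : k <= l -> R l z y -> R k z y.
  by move=> /subnK <-; elim: (l - k) => //= d IH /R1.
(* Any two points of the section at stage [K i.+1] agree below [i.+1], hence at coordinate [i]. *)
pose f z i := sval (R2 (K i.+1) z) i.
have fP l : exists k, forall z y, R k z y -> agree l y (f z).
  exists (\max_(i < l) K i.+1) => z y h i il.
  have [k' {}R4] := R4 i.+1; apply: (R4 z z y (sval (R2 (K i.+1) z))) => //;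
    last exact: (svalP (R2 (K i.+1) z)).
  by apply: Rle h; apply: (leq_bigmax (Ordinal il)).
have Rf k z : R k z (f z).
  have [L hL] := R3 k z; have [k0 h0] := fP L.
  have [y hy] := R2 (maxn k k0) z.
  rewrite -(hL y); first by apply: Rle hy; rewrite leq_maxl.
  by apply: h0; apply: Rle hy; rewrite leq_maxr.
exists f; split=> // l; have [k' {}R4] := R4 l.
by exists k' => z y h; apply: R4 h _ _; exact: Rf.
Qed.

Lemma limit_homeo (R : nat -> Cantor -> Cantor -> Prop) :
  (forall k z y, R k.+1 z y -> R k z y) ->
  (forall k z, exists y, R k z y) ->
  (forall k y, exists z, R k z y) ->
  (forall k z, loc (R k z)) ->
  (forall k y, loc (fun z => R k z y)) ->
  (forall l, exists k k', forall z z' y y',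
     agree k' z z' -> R k z y -> R k z' y' -> agree l y y') ->
  (forall l, exists k k', forall z z' y y',
     agree k' y y' -> R k z y -> R k z' y' -> agree l z z') ->
  exists h : homeo, (forall k z, R k z (hfun h z)) /\
    forall z y, (forall k, R k z y) -> hfun h z = y.
Proof.
move=> R1 R2 R2' R3 R3' R4 R4'.
have [f [Rf cf]] := limit_fun R1 R2 R3 R4.
have [||||g [Rg cg]] := @limit_fun (fun k y z => R k z y) => //.
- by move=> k z y; exact: R1.
- by move=> l; have [k [k' hk]] := R4' l; exists k, k' => z z' y y'; exact: hk.
have uniq z y : (forall k, R k z y) -> f z = y.
  by move=> h; apply: agree_eq => l; have [k [k' hk]] := R4 l; apply: (hk z z).
have fK : cancel f g.
  by move=> z; apply: agree_eq => l; have [k [k' hk]] := R4' l; apply: (hk _ _ (f z) (f z)).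
have gK : cancel g f by move=> y; exact: uniq.
by exists (Homeo (ucont_continuous cf) (ucont_continuous cg) fK gK).
Qed.

(** * Colourings and back-and-forth *)

Definition onto T U (u : T -> U) := forall a, exists z, u z = a.

Definition sep T l (u : Cantor -> T) := forall z y, u z = u y -> agree l z y.

Lemma agree_separates (I : finType) (pt : I -> Cantor) :
  injective pt -> exists L, forall s s', agree L (pt s) (pt s') -> s = s'.
Proof.
move=> ipt.
have /choice[l hl] (ss : I * I) :
    exists l, agree l (pt ss.1) (pt ss.2) -> ss.1 = ss.2.
  apply: contrapT => /forallNP h; have [] := h 0; move=> _.
  by apply/ipt/agree_eq => k; have /not_implyP[] := h k.
exists (\max_ss l ss) => s s' h; apply: (hl (s, s')).
by apply: agree_le h; exact: leq_bigmax.
Qed.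

Section Pointed.
Variables (n : nat) (x : 'I_n -> Cantor).
Hypothesis hx : injective x.

(* The points [y] carry a single 1 beyond coordinate [k], at pairwise different
   positions, hence are distinct; late enough positions also avoid the [x i]. *)
Lemma fresh_points k (C : finType) (z : C -> Cantor) :
  exists y : C -> Cantor, (forall c, agree k (z c) (y c)) /\
    injective (fun s : 'I_n + C => match s with inl i => x i | inr c => y c end).
Proof.
pose spike (w : Cantor) j : Cantor := fun i => if i < k then w i else i == k + j.
have spike_inj w w' j j' : spike w j = spike w' j' -> j = j'.
  move=> /(congr1 (fun f : Cantor => f (k + j))).
  by rewrite /spike ltnNge leq_addr /= eqxx eqn_add2l => /esym/eqP.
have /choice[b hb] (i : 'I_n) : exists b, forall j w, b < j -> spike w j <> x i.
  have [[j [w e]]|/forallNP h] := pselect (exists j w, spike w j = x i).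
    by exists j => j' w' jj' e'; move: jj'; rewrite (spike_inj w w' j j') ?ltnn // e.
  by exists 0 => j w _ e; apply: (h j); exists w.
pose N := (\max_i b i).+1.
have hN (i : 'I_n) j w : spike w (N + j) <> x i.
  by apply: hb; rewrite addSn ltnS; apply: leq_trans (leq_addr _ _); exact: leq_bigmax.
exists (fun c => spike (z c) (N + enum_rank c)); split.
  by move=> c i ik; rewrite /spike ik.
move=> [i|c] [i'|c'].
- by move=> /hx ->.
- by move=> /esym /hN.
- by move=> /hN.
- by move=> /spike_inj /addnI /val_inj /enum_rank_inj ->.
Qed.

(** As no point is isolated, every colour [c] gets its own point in the fibre of [q] over [phi c],
    away from the [x i]. Small cylinders around these points and the [x i] receive the prescribed
    colours, and a section of [phi] colours the rest. *)
Lemma refine_coloring (A C : finType) (q : Cantor -> A) (phi : C -> A) (p : 'I_n -> C) :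
  loc q -> onto q -> onto phi -> (forall i, phi (p i) = q (x i)) ->
  exists q', [/\ loc q', onto q', forall z, phi (q' z) = q z & forall i, q' (x i) = p i].
Proof.
move=> [k hk] oq /choice[sec secK] hp.
have /choice[z hz] (c : C) := oq (phi c).
have [y [zy ipt]] := fresh_points k z.
set pt := (fun s : _ + _ => _) in ipt.
pose kap (s : 'I_n + C) := match s with inl i => p i | inr c => c end.
have hkap s : phi (kap s) = q (pt s).
  by case: s => [i|c] //=; rewrite -(hk _ _ (zy c)) hz.
have [L hL] := agree_separates ipt.
(* Length [L] separates the chosen points; length [k] keeps each cylinder inside a fibre of [q]. *)
pose M := maxn k L.
pose q' z := if [pick s | `[< agree M (pt s) z >]] is Some s then kap s else sec (q z).
have q'pt s : q' (pt s) = kap s.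
  rewrite /q'; case: pickP => [s' /asboolP h|/(_ s) /asboolP[]//].
  by congr kap; apply: hL; apply: agree_le h; exact: leq_maxr.
exists q'; split.
- exists M => a b ab; rewrite /q' (hk a b); last by apply: agree_le ab; exact: leq_maxl.
  congr (if _ is Some _ then _ else _); apply: eq_pick => s.
  apply/asbool_equiv_eq; split=> h; apply: agree_trans h _ => //.
  exact: agree_sym.
- by move=> c; exists (pt (inr c)); rewrite q'pt.
- move=> w; rewrite /q'; case: pickP => [s /asboolP h|_]; last exact: secK.
  by rewrite hkap; apply: hk; apply: agree_le h; exact: leq_maxl.
- by move=> i; rewrite -[x i]/(pt (inl i)) q'pt.
Qed.

Section BackAndForth.
Variable P : forall E : finType, (Cantor -> E) -> (Cantor -> E) -> Prop.
Hypothesis P_ok : forall E u v, @P E u v ->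
  [/\ loc u, loc v, onto u, onto v & forall i, u (x i) = v (x i)].
Hypothesis P_forth : forall E u v l, @P E u v ->
  exists (E' : finType) u' v' (f : E' -> E),
    [/\ P u' v', forall z, f (u' z) = u z, forall z, f (v' z) = v z & sep l u'].
Hypothesis P_back : forall E u v l, @P E u v ->
  exists (E' : finType) u' v' (f : E' -> E),
    [/\ P u' v', forall z, f (u' z) = u z, forall z, f (v' z) = v z & sep l v'].

Record bf_state := BFState {
  bf_car : finType;
  bf_u : Cantor -> bf_car;
  bf_v : Cantor -> bf_car;
  bf_ok : P bf_u bf_v }.

Let bf_refines (s s' : bf_state) := exists f : bf_car s' -> bf_car s,
  (forall z, f (bf_u s' z) = bf_u s z) /\ forall z, f (bf_v s' z) = bf_v s z.

Let bf_step l (s : bf_state) :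
  exists s', [/\ bf_refines s s', sep l (bf_u s') & sep l (bf_v s')].
Proof.
have [E [u [v [f [Puv fu fv su]]]]] := P_forth l (bf_ok s).
have [E' [u' [v' [f' [Puv' fu' fv' sv']]]]] := P_back l Puv.
exists (BFState Puv'); split=> //=.
  by exists (f \o f'); split=> z /=; rewrite ?fu' ?fv' ?fu ?fv.
by move=> z y e; apply: su; rewrite -!fu' e.
Qed.

(** The relations [u z = v y] along a chain of pairs refined alternately on both sides shrink to the
    graph of [g]. The last clause keeps arbitrarily fine stages available, for proving further
    properties of [g]. *)
Lemma back_and_forth E u v : @P E u v ->
  exists g, [/\ stab x g, forall z, v (hfun g z) = u z &
    forall l, exists (E' : finType) u' v',
      [/\ @P E' u' v', forall z, v' (hfun g z) = u' z & sep l v']].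
Proof.
move=> Puv.
pose nxt l s := sval (cid (bf_step l s)).
pose S := fix S k := if k is k'.+1 then nxt k' (S k') else BFState Puv.
have nxtP l s : [/\ bf_refines s (nxt l s), sep l (bf_u (nxt l s)) & sep l (bf_v (nxt l s))].
  exact: (svalP (cid (bf_step l s))).
pose R k z y := bf_u (S k) z = bf_v (S k) y.
have ok k := P_ok (bf_ok (S k)).
have [|||||||g [Rg ug]] := @limit_homeo R.
- move=> k z y; rewrite /R /=.
  by have [[f [fu fv]] _ _] := nxtP k (S k); rewrite -fu -fv => ->.
- by move=> k z; have [_ _ _ /(_ (bf_u (S k) z))[y e] _] := ok k; exists y.
- by move=> k y; have [_ _ /(_ (bf_v (S k) y))[z e] _ _] := ok k; exists z.
- by move=> k z; have [_ l _ _ _] := ok k; exact: loc_comp l.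
- move=> k y; have [l _ _ _ _] := ok k.
  exact: (@loc_comp _ _ _ (fun e => e = bf_v (S k) y) l).
(* Stage [l.+1] is the one produced by step [l], so its colourings separate up to [l]. *)
- move=> l; exists l.+1; have [[k' hk'] _ _ _ _] := ok l.+1.
  have [_ _ sv] := nxtP l (S l).
  by exists k' => z z' y y' /hk' e; rewrite /R => h h'; apply: sv; rewrite -h -h'.
- move=> l; exists l.+1; have [_ [k' hk'] _ _ _] := ok l.+1.
  have [_ su _] := nxtP l (S l).
  by exists k' => z z' y y' /hk' e; rewrite /R => h h'; apply: su; rewrite h h'.
exists g; split.
- by move=> i; apply: ug => k; have [_ _ _ _ h] := ok k; exact: h.
- by move=> z; have := Rg 0 z.
- move=> l; exists (bf_car (S l.+1)), (bf_u (S l.+1)), (bf_v (S l.+1)).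
  by split=> [|z|]; [exact: bf_ok|rewrite Rg|have [] := nxtP l (S l)].
Qed.

End BackAndForth.

Lemma loc_image (T : finType) (u : Cantor -> T) : loc u ->
  exists (E : finType) (q : Cantor -> E) (f : E -> T),
    [/\ loc q, onto q & forall z, f (q z) = u z].
Proof.
move=> [k hk].
have uP z : `[< exists z', u z' = u z >] by apply/asboolP; exists z.
exists {a : T | `[< exists z, u z = a >]}, (fun z => exist _ (u z) (uP z)), val.
split=> //; first by exists k => z y /hk e; apply: val_inj.
by case=> a aP; have /asboolP[z e] := aP; exists z; apply: val_inj.
Qed.

(** Back-and-forth in which agreement at the [x i] is the only constraint: a refinement of one
    colouring is copied to the other by [refine_coloring]. *)
Lemma homogeneity (E : finType) (u v : Cantor -> E) :
  loc u -> loc v -> onto u -> onto v -> (forall i, u (x i) = v (x i)) ->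
  exists g, stab x g /\ forall z, v (hfun g z) = u z.
Proof.
pose P (E : finType) (u v : Cantor -> E) :=
  [/\ loc u, loc v, onto u, onto v & forall i, u (x i) = v (x i)].
have ext (F : finType) (a b : Cantor -> F) l : P F a b ->
    exists (F' : finType) a' b' (f : F' -> F),
    [/\ P F' a' b', forall z, f (a' z) = a z, forall z, f (b' z) = b z & sep l a'].
  move=> [la lb oa ob eab].
  have [F' [a' [f [la' oa' fa']]]] := loc_image (loc_pair la (loc_lvl l)).
  have fa z : (f (a' z)).1 = a z by rewrite fa'.
  have [||b' [lb' ob' fb eb]] := @refine_coloring _ _ b (fst \o f) (a' \o x) lb ob.
  - by move=> e; have [z <-] := oa e; exists (a' z); rewrite /= fa.
  - by move=> i /=; rewrite fa.
  exists F', a', b', (fst \o f); split=> //; first by split=> // i; rewrite eb.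
  by move=> z y e; apply: lvl_agree; move: (fa' z) (fa' y); rewrite e => -> [].
move=> lu lv ou ov euv.
have [||||g [sg gu _]] := @back_and_forth P _ _ _ E u v; last by exists g.
- by [].
- exact: ext.
- move=> F a b l [la lb oa ob eab].
  have [|F' [b' [a' [f [[? ? ? ? ?] ? ? ?]]]]] := @ext F b a l; first by split.
  by exists F', a', b', f; split=> //; split.
- by split.
Qed.

End Pointed.

(** * Finite structures and amalgamation *)

(* [(j, true)] stands for the j-th generator of the free group of rank [m] and
   [(j, false)] for its inverse. *)
Definition dir m := ('I_m * bool)%type.

Definition dinv m (d : dir m) : dir m := (d.1, ~~ d.2).

Lemma dinvK m : involutive (@dinv m).
Proof. by case=> j b; rewrite /dinv /= negbK. Qed.

(** The finite core of König's lemma, used to pass from paths of every finite length to infinite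
    ones. *)
Lemma fin_pigeon (T : finType) (Q : nat -> pred T) :
  (forall k t, Q k.+1 t -> Q k t) -> (forall k, exists t, Q k t) ->
  exists t, forall k, Q k t.
Proof.
move=> Qdec Qex; apply: contrapT => /forallNP h.
have /choice[K hK] t : exists k, ~ Q k t by apply/existsNP/h.
have [t ht] := Qex (\max_t K t); apply: (hK t).
have : K t <= \max_t K t by exact: leq_bigmax.
by move=> /subnK; move: ht => /[swap] <-; elim: (_ - _) => // d IH /Qdec.
Qed.

Section Structures.
Variables (n m : nat).

(** Totality in the direction [dinv d] gives surjectivity in the direction [d]. *)
Definition valid (A : finType) (ed : dir m -> rel A) (mk : 'I_n -> A) :=
  [/\ forall d a b, ed d a b = ed (dinv d) b a,
      forall d a, exists b, ed d a b &
      forall d i, ed d (mk i) (mk i)].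

Record mstruct := MStruct {
  car :> finType;
  ed : dir m -> rel car;
  mk : 'I_n -> car;
  mvalid : valid ed mk }.
Arguments ed {m0} _ _ _ : rename.
Arguments mk {m0} _ : rename.

Lemma ed_sym (A : mstruct) d (a b : A) : ed d a b -> ed (dinv d) b a.
Proof. by have [<-] := mvalid A. Qed.

Lemma ed_tot (A : mstruct) d (a : A) : exists b, ed d a b.
Proof. by have [_ h _] := mvalid A. Qed.

Lemma ed_loop (A : mstruct) d i : ed d (mk i : A) (mk i).
Proof. by have [_ _ h] := mvalid A. Qed.

Definition epi (C A : mstruct) (phi : C -> A) :=
  [/\ forall d c c', ed d c c' -> ed d (phi c) (phi c'),
      onto phi,
      forall d a a', ed d a a' ->
        exists c c', [/\ ed d c c', phi c = a & phi c' = a'] &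
      forall i, phi (mk i) = mk i].

Lemma epi_comp (A B C : mstruct) (f : B -> A) (g : C -> B) :
  epi f -> epi g -> epi (f \o g).
Proof.
move=> [f1 f2 f3 f4] [g1 g2 g3 g4]; split=> /=.
- by move=> d c c' /g1 /f1.
- by move=> a; have [b <-] := f2 a; have [c <-] := g2 b; exists c.
- move=> d a a' /f3[b [b' [/g3[c [c' [? <- <-]]] <- <-]]].
  by exists c, c'.
- by move=> i; rewrite g4 f4.
Qed.

(** Amalgamation bases in the projective sense: extensions of [A] are structures mapping onto it. *)
Definition good (A : mstruct) :=
  forall (C D : mstruct) (phi : C -> A) (psi : D -> A), epi phi -> epi psi ->
  exists (E : mstruct) (f : E -> C) (g : E -> D),
    [/\ epi f, epi g & forall e, phi (f e) = psi (g e)].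

Section Amalgam.
Variables (C D : mstruct) (Z : pred (C * D)).

(** Amalgams are taken inside the product, on a set [Z] of pairs. The whole fibre product may fail
    to be total, so [Z] must be chosen closed under taking some neighbour in every direction. *)
Definition amalgam_ed d (e e' : {p | Z p}) :=
  ed d (val e).1 (val e').1 && ed d (val e).2 (val e').2.

Hypothesis Zmk : forall i, Z (mk i, mk i).
Hypothesis Ztot : forall d c b, Z (c, b) ->
  exists c' b', [/\ Z (c', b'), ed d c c' & ed d b b'].

Lemma amalgam_valid :
  valid amalgam_ed (fun i => exist Z (mk i, mk i) (Zmk i)).
Proof.
split=> [d a b|d [[c b] zcb]|d i]; rewrite /amalgam_ed /=.
- by have [<- _ _] := mvalid C; have [<- _ _] := mvalid D.
- have [c' [b' [z cc bb]]] := Ztot d zcb.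
  by exists (exist Z (c', b') z); rewrite /= cc bb.
- by rewrite !ed_loop.
Qed.

Definition amalgam := MStruct amalgam_valid.

Lemma amalgam_epil :
  (forall c, exists b, Z (c, b)) ->
  (forall d c c', ed d c c' ->
     exists b b', [/\ Z (c, b), Z (c', b') & ed d b b']) ->
  epi (fun e : amalgam => (val e).1).
Proof.
move=> Z1 Z2; split=> //=.
- by move=> d a b /andP[].
- by move=> c; have [b z] := Z1 c; exists (exist Z (c, b) z).
- move=> d c c' h; have [b [b' [z z' hb]]] := Z2 d c c' h.
  by exists (exist Z (c, b) z), (exist Z (c', b') z'); rewrite /amalgam_ed /= h.
Qed.

Lemma amalgam_epir :
  (forall b, exists c, Z (c, b)) ->
  (forall d b b', ed d b b' ->
     exists c c', [/\ Z (c, b), Z (c', b') & ed d c c']) ->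
  epi (fun e : amalgam => (val e).2).
Proof.
move=> Z1 Z2; split=> //=.
- by move=> d a b /andP[].
- by move=> b; have [c z] := Z1 b; exists (exist Z (c, b) z).
- move=> d b b' h; have [c [c' [z z' hb]]] := Z2 d b b' h.
  by exists (exist Z (c, b) z), (exist Z (c', b') z'); rewrite /amalgam_ed /= h hb.
Qed.

End Amalgam.

Lemma mpoint_valid : @valid unit (fun _ _ _ => true) (fun=> tt).
Proof. by split=> //; exists tt. Qed.

Definition mpoint := MStruct mpoint_valid.

(** Over a point the full product is an amalgam. This gives the back-and-forth its initial pair. *)
Lemma good_mpoint : good mpoint.
Proof.
move=> C D phi psi [_ ontoC _ _] [_ ontoD _ _].
have [c0 _] := ontoC tt; have [d0 _] := ontoD tt.
have Zt d (c : C) (b : D) : xpredT (c, b) ->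
    exists c' b', [/\ xpredT (c', b'), ed d c c' & ed d b b'].
  by move=> _; have [c' hc] := ed_tot d c; have [b' hb] := ed_tot d b; exists c', b'.
exists (@amalgam C D xpredT (fun=> isT) Zt), (fun e => (val e).1), (fun e => (val e).2).
split; last by move=> e; case: (phi _) (psi _) => -[].
- apply: amalgam_epil; first by exists d0.
  by move=> d c c' h; have [b hb] := ed_tot d d0; exists d0, b.
- apply: amalgam_epir; first by exists c0.
  by move=> d c c' h; have [b hb] := ed_tot d c0; exists c0, b.
Qed.

(** * Unfoldings as amalgamation bases *)

Section Unfolding.
Variable A : mstruct.

Definition nx (a : A) (d : dir m) : A := sval (cid (ed_tot d a)).

Lemma nxP a d : ed d a (nx a d).
Proof. exact: (svalP (cid (ed_tot d a))). Qed.

(* [inl (inl (a, f))] is an origin over [a], all of whose neighbours are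
   prescribed by [f] (with [nx] as a fallback for inadmissible values of [f]);
   [inl (inr (a, e))] is a vertex over [a] all of whose neighbours are prescribed,
   except those in the direction [e] leading back to an origin;
   [inr i] is an isolated vertex with loops. *)
Definition ucar : finType :=
  (((A * {ffun dir m -> A}) + (A * dir m)) + 'I_n)%type.

Definition ustep (d : dir m) (b : ucar) : option ucar :=
  match b with
  | inl (inl (a, f)) =>
      Some (inl (inr (if ed d a (f d) then f d else nx a d, dinv d)))
  | inl (inr (a, e)) =>
      if d == e then None else Some (inl (inr (nx a d, dinv d)))
  | inr i => Some (inr i)
  end.

Definition uproj (b : ucar) : A :=
  match b with inl (inl (a, _)) => a | inl (inr (a, _)) => a | inr i => mk i end.

Definition ued d (b b' : ucar) := (ustep d b == Some b') || (ustep (dinv d) b' == Some b).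

Lemma unfolding_valid : valid ued (fun i => inr i).
Proof.
split.
- by move=> d a b; rewrite /ued dinvK orbC.
- move=> d [[[a f]|[a e]]|i].
  + by eexists; apply/orP; left; exact: eqxx.
  + have [->|de] := eqVneq d e; last first.
      by eexists; apply/orP; left; rewrite /= (negPf de); exact: eqxx.
    (* An origin over [nx a e] prescribing [a] everywhere: the prescription is admissible in
       direction [dinv e], by symmetry of edges. *)
    exists (inl (inl (nx a e, [ffun => a]))); apply/orP; right => /=.
    by rewrite ffunE (ed_sym (nxP a e)) dinvK.
  + by exists (inr i); apply/orP; left.
- by move=> d i; apply/orP; left.
Qed.

Definition unfolding := MStruct unfolding_valid.

Lemma uproj_step d b b' : ustep d b = Some b' -> ed d (uproj b) (uproj b').
Proof.
case: b => [[[a f]|[a e]]|i] /=.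
- by move=> [<-] /=; case: ifP => // _; exact: nxP.
- by case: eqP => // _ [<-] /=; exact: nxP.
- by move=> [<-]; exact: ed_loop.
Qed.

Lemma unfolding_epi : epi (uproj : unfolding -> A).
Proof.
split=> //.
- move=> d c c' /orP[/eqP/uproj_step//|/eqP/uproj_step h].
  by rewrite -[d]dinvK ed_sym.
- by move=> a; exists (inl (inl (a, [ffun => a]))).
(* Origins with arbitrary prescriptions exist precisely so that every edge of [A] lifts. *)
- move=> d a a' h; exists (inl (inl (a, [ffun => a']))), (inl (inr (a', dinv d))).
  by split=> //; apply/orP; left; rewrite /= ffunE h.
Qed.

(** A different neighbour would have to step onto [b]; then [b] would remember [d] as its way back,
    and [ustep d b] would be [None]. *)
Lemma ustep_uniq d (b b' b'' : unfolding) :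
  ustep d b = Some b' -> ed d b b'' -> b'' = b'.
Proof.
move=> h /orP[|]; first by rewrite h => /eqP[].
case: b'' => [[[a f]|[a e]]|i] /=.
- by move=> /eqP[bE]; move: h; rewrite -bE /= dinvK eqxx.
- by case: ifP => // _ /eqP[bE]; move: h; rewrite -bE /= dinvK eqxx.
- by move=> /eqP[bE]; move: h; rewrite -bE /= => -[].
Qed.

(* The direction of [b] leading back to an origin. *)
Definition uback (b : ucar) : option (dir m) :=
  if b is inl (inr (_, e)) then Some e else None.

Lemma ustep_uback d b : ustep d b = None <-> uback b = Some d.
Proof.
case: b => [[[a f]|[a e]]|i] //=; case: eqP => [->|ne] //=; split=> // -[] e'.
by rewrite e' in ne.
Qed.

Lemma ustep_uback_target d b b' :
  ustep d b = Some b' -> uback b' = None \/ uback b' = Some (dinv d).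
Proof.
case: b => [[[a f]|[a e]]|i] /=; last by move=> [<-]; left.
- by move=> [<-]; right.
- by case: eqP => // _ [<-]; right.
Qed.

(* [back_path k (c, b)]: from [(c, b)] there is a common path of length [k] in the
   pullback, heading back to the origin or ending there earlier. *)
Fixpoint back_path (C D : mstruct) (phi : C -> unfolding) (psi : D -> unfolding)
    k (p : C * D) : bool :=
  (phi p.1 == psi p.2) && if k is k'.+1 then
    if uback (phi p.1) is Some e then
      [exists p' : C * D, [&& ed e p.1 p'.1, ed e p.2 p'.2 & back_path phi psi k' p']]
    else true
  else true.

(** The set [Z] for amalgamation over an unfolding. By finiteness, a back path can be continued
    within this set ([back_ray_back]). *)
Definition back_ray (C D : mstruct) (phi : C -> unfolding) (psi : D -> unfolding) p :=
  `[< forall k, back_path phi psi k p >].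

Section UnfoldingPullback.
Variables (C D : mstruct) (phi : C -> unfolding) (psi : D -> unfolding).
Hypotheses (ephi : epi phi) (epsi : epi psi).
Local Notation back_path := (back_path phi psi).
Local Notation back_ray := (back_ray phi psi).

Lemma back_path_dec k p : back_path k.+1 p -> back_path k p.
Proof.
elim: k p => [|k IH] p; first by rewrite /= => /andP[->].
rewrite [in X in X -> _]/= => /andP[e h]; rewrite /= e /=.
case: (uback _) h => // d /existsP[p' /and3P[? ? /IH ?]].
by apply/existsP; exists p'; apply/and3P.
Qed.

Lemma back_ray_phi c b : back_ray (c, b) -> phi c = psi b.
Proof. by move=> /asboolP/(_ 0)/andP[/eqP]. Qed.

Lemma back_ray_back c b e : back_ray (c, b) -> uback (phi c) = Some e ->
  exists c' b', [/\ back_ray (c', b'), ed e c c' & ed e b b'].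
Proof.
move=> /asboolP h ub.
have [||[c' b'] h'] :=
    @fin_pigeon _ (fun k (p : C * D) => [&& ed e c p.1, ed e b p.2 & back_path k p]).
- by move=> k p /and3P[? ? /back_path_dec ?]; apply/and3P.
- by move=> k; have := h k.+1; rewrite /= ub => /andP[_ /existsP].
exists c', b'; have /and3P[? ? _] := h' 0; split=> //.
by apply/asboolP => k; have /and3P[] := h' k.
Qed.

Lemma back_ray_intro c b : phi c = psi b ->
  (forall e, uback (phi c) = Some e ->
     exists c' b', [/\ back_ray (c', b'), ed e c c' & ed e b b']) ->
  back_ray (c, b).
Proof.
move=> e h; apply/asboolP => -[|k]; rewrite /= e eqxx //= -e.
case: (uback _) h => // d /(_ d erefl)[c' [b' [/asboolP h1 h2 h3]]].
by apply/existsP; exists (c', b'); rewrite h2 h3 h1.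
Qed.

(** Away from the origin, [c'] and [b'] both lie over the forced vertex [v], and a way back from
    [v], if any, returns to [(c, b)]. *)
Lemma back_ray_step d c b c' b' v : back_ray (c, b) -> ustep d (phi c) = Some v ->
  ed d c c' -> ed d b b' -> back_ray (c', b').
Proof.
move=> z hv hc hb; have [ephi1 _ _ _] := ephi; have [epsi1 _ _ _] := epsi.
have ec : phi c' = v by apply: ustep_uniq hv _; exact: ephi1.
have eb : psi b' = v.
  by apply: (@ustep_uniq d (phi c)) hv _; rewrite (back_ray_phi z); exact: epsi1.
apply: back_ray_intro; rewrite ?ec ?eb // => e ve; exists c, b.
have [|] := ustep_uback_target hv; rewrite ve => // -[->].
by split=> //; exact: ed_sym.
Qed.

Lemma back_ray_tot d c b : back_ray (c, b) ->
  exists c' b', [/\ back_ray (c', b'), ed d c c' & ed d b b'].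
Proof.
move=> z; case E : (ustep d (phi c)) => [v|]; last first.
  by apply: back_ray_back z _; exact/ustep_uback.
have [c' hc] := ed_tot d c; have [b' hb] := ed_tot d b.
by exists c', b'; split=> //; exact: back_ray_step z E hc hb.
Qed.

Lemma back_ray_ex c : exists b, back_ray (c, b).
Proof.
have [ephi1 _ _ _] := ephi; have [epsi1 opsi _ _] := epsi.
have [||b hb] := @fin_pigeon _ (fun k b => back_path k (c, b)); last 1 first.
- by exists b; apply/asboolP.
- by move=> k b; exact: back_path_dec.
move=> k; elim: k c => [|k IH] c /=.
  by have [b e] := opsi (phi c); exists b; rewrite e eqxx.
case E : (uback (phi c)) => [e|]; last first.
  by have [b e] := opsi (phi c); exists b; rewrite e eqxx.
(* Step back to [c1], lift the rest of the path from there, then return to some [b]. The return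
   moves away from the origin, so [psi b] is forced to equal [phi c]. *)
have [c1 hc1] := ed_tot e c; have [b1 hb1] := IH c1.
have [b hb] := ed_tot (dinv e) b1; exists b.
have e1 : phi c1 = psi b1 by case: (k) hb1 => [|k'] /= /andP[/eqP].
have e2 : phi c = psi b.
  apply/esym/(@ustep_uniq (dinv e) (phi c1)); last by rewrite e1; exact: epsi1.
  have /orP[/eqP|/eqP //] := ephi1 _ _ _ hc1.
  by have /ustep_uback -> := E.
rewrite e2 eqxx; apply/existsP; exists (c1, b1); rewrite /= hc1 hb1 andbT.
by rewrite -[e]dinvK; exact: ed_sym.
Qed.

Lemma back_ray_edge d c c' : ed d c c' ->
  exists b b', [/\ back_ray (c, b), back_ray (c', b') & ed d b b'].
Proof.
move=> h; have [ephi1 _ _ _] := ephi.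
(* One orientation of the edge is a forced step; lift it from its source. *)
have /orP[/eqP st|/eqP st] := ephi1 _ _ _ h.
  have [b z] := back_ray_ex c; have [b' hb] := ed_tot d b.
  by exists b, b'; split=> //; apply: back_ray_step z st h hb.
have [b' z] := back_ray_ex c'; have [b hb] := ed_tot (dinv d) b'.
exists b, b'; split=> //; last by rewrite -[d]dinvK; exact: ed_sym.
by apply: back_ray_step z st _ hb; exact: ed_sym.
Qed.

Lemma back_ray_mk i : back_ray (mk i, mk i).
Proof.
have [_ _ _ h] := ephi; have [_ _ _ h'] := epsi.
by apply: back_ray_intro; rewrite h ?h'.
Qed.

End UnfoldingPullback.

Lemma back_ray_swap (C D : mstruct) (phi : C -> unfolding) (psi : D -> unfolding) c b :
  back_ray phi psi (c, b) -> back_ray psi phi (b, c).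
Proof.
move=> /asboolP h; apply/asboolP => k; move: (h k).
elim: k c b {h} => [|k IH] c b /= /andP[/eqP e]; rewrite e eqxx //=.
case: (uback _) => // d /existsP[[c' b'] /and3P[/= ? ? /IH ?]].
by apply/existsP; exists (b', c'); apply/and3P.
Qed.

(* In the tree of neighbours of a vertex of the unfolding everything is
   determined when moving away from an origin, so a path towards an origin can be
   lifted from its far end; by finiteness infinite paths lift as well. *)
Lemma good_unfolding : good unfolding.
Proof.
move=> C D phi psi ephi epsi.
exists (@amalgam C D (back_ray phi psi) (back_ray_mk ephi epsi) (back_ray_tot ephi epsi)),
  (fun e => (val e).1), (fun e => (val e).2); split.
- by apply: amalgam_epil; [exact: back_ray_ex|exact: back_ray_edge].
- apply: amalgam_epir.
    by move=> b; have [c /back_ray_swap ?] := back_ray_ex epsi ephi b; exists c.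
  move=> d b b' /(back_ray_edge epsi ephi)[c [c' [/back_ray_swap ? /back_ray_swap ? ?]]].
  by exists c, c'.
- by case=> -[c b] z; exact: back_ray_phi z.
Qed.

End Unfolding.
End Structures.

(** * Realisation of structures *)

Definition act m (t : 'I_m -> homeo) (d : dir m) (z : Cantor) : Cantor :=
  if d.2 then hfun (t d.1) z else hinv (t d.1) z.

Lemma actK m (t : 'I_m -> homeo) d : cancel (act t d) (act t (dinv d)).
Proof. by case: d => j [] z; rewrite /act /= ?hfunK ?hinvK. Qed.

Lemma actVK m (t : 'I_m -> homeo) d : cancel (act t (dinv d)) (act t d).
Proof. by move=> z; rewrite -{1}[d]dinvK actK. Qed.

Lemma act_continuous m (t : 'I_m -> homeo) d : continuous (act t d).
Proof. by case: d => j [] z; [exact: hfun_cont|exact: hinv_cont]. Qed.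

Section Realisation.
Variables (n : nat) (x : 'I_n -> Cantor).
Hypothesis hx : injective x.
Variable m : nat.
Local Notation mstruct := (mstruct n m).
Local Notation tuples := (@tuples n x m).
Implicit Types (t s : 'I_m -> homeo) (A B C D E : mstruct).

Lemma act_fix t d i : tuples t -> act t d (x i) = x i.
Proof.
move=> ht; case: d => j [] /=; rewrite /act /= ?ht //.
by rewrite -{1}(ht j i) hfunK.
Qed.

(** [A] is exactly the quotient of the action by the partition into fibres of [q]: every edge has a
    witness. *)
Definition realises t A (q : Cantor -> A) :=
  [/\ loc q, onto q, forall i, q (x i) = mk A i &
      forall d a a', ed d a a' <-> exists z, q z = a /\ q (act t d z) = a'].

Lemma realisesI t A (q : Cantor -> A) :
  loc q -> onto q -> (forall i, q (x i) = mk A i) ->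
  (forall j a a', ed (j, true) a a' <->
     exists z, q z = a /\ q (hfun (t j) z) = a') ->
  realises t q.
Proof.
move=> lq oq mq hq; split=> // -[j []] a a'; first exact: hq.
split=> [/ed_sym/hq[z [za za']]|[z [za za']]].
  by exists (hfun (t j) z); rewrite /act /= hfunK.
rewrite -[(j, false)]dinvK; apply: ed_sym; apply/hq.
by exists (hinv (t j) z); rewrite hinvK.
Qed.

Lemma realises_ed t A (q : Cantor -> A) d z :
  realises t q -> ed d (q z) (q (act t d z)).
Proof. by case=> _ _ _ h; apply/h; exists z. Qed.

Lemma realises_colorings t (T : finType) (u : Cantor -> T) : tuples t -> loc u ->
  exists A (q : Cantor -> A) (f : A -> T), realises t q /\ forall z, f (q z) = u z.
Proof.
move=> ht /loc_image[A [q [f [lq oq fq]]]].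
pose e d (a a' : A) := `[< exists z, q z = a /\ q (act t d z) = a' >].
have ve : @valid n m A e (q \o x).
  split=> [d a a'|d a|d i].
  - apply/asbool_equiv_eq; split=> -[z [<- <-]].
      by exists (act t d z); rewrite actK.
    by exists (act t (dinv d) z); rewrite actVK.
  - by have [z <-] := oq a; exists (q (act t d z)); apply/asboolP; exists z.
  - by apply/asboolP; exists (x i); rewrite act_fix.
exists (MStruct ve), q, f; split=> //; split=> //= d a a'.
by split=> /asboolP.
Qed.

Lemma realises_comp t A B (q : Cantor -> A) (f : A -> B) :
  realises t q -> epi f -> realises t (f \o q).
Proof.
move=> [lq oq mq hq] [f1 f2 f3 f4]; split.
- exact: loc_comp.
- by move=> b; have [a <-] := f2 b; have [z <-] := oq a; exists z.
- by move=> i /=; rewrite mq f4.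
- move=> d b b'; split=> [/f3[a [a' [/hq[z [<- <-]] <- <-]]]|[z [<- <-]]].
    by exists z.
  by apply/f1/hq; exists z.
Qed.

Lemma realises_epi t A C (q : Cantor -> A) (q' : Cantor -> C) (phi : C -> A) :
  realises t q -> realises t q' -> (forall z, phi (q' z) = q z) -> epi phi.
Proof.
move=> [lq oq mq hq] [lq' oq' mq' hq'] e; split.
- by move=> d c c' /hq'[z [<- <-]]; rewrite !e; apply/hq; exists z.
- by move=> a; have [z <-] := oq a; exists (q' z).
- move=> d a a' /hq[z [<- <-]]; exists (q' z), (q' (act t d z)).
  by rewrite !e; split=> //; apply/hq'; exists z.
- by move=> i; rewrite -mq' e mq.
Qed.

(** Refine [q] to a colouring [q'] by [C]. For each generator, refine [q'] further by edges in two
    ways, as sources and as targets; a homeomorphism given by [homogeneity] matches these two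
    colourings and so realises exactly the edges. *)
Lemma realise_extension t A C (q : Cantor -> A) (phi : C -> A) :
  realises t q -> epi phi -> exists t' (q' : Cantor -> C),
    [/\ tuples t', realises t' q' & forall z, phi (q' z) = q z].
Proof.
move=> [lq oq mq _] [_ ophi _ mphi].
have [|q' [lq' oq' eq' mq']] := @refine_coloring n x hx _ _ q phi (@mk _ _ C) lq oq ophi.
  by move=> i; rewrite mphi mq.
have /choice[t' ht'] (j : 'I_m) : exists g, stab x g /\
    forall c c', ed (j, true) c c' <-> exists z, q' z = c /\ q' (hfun g z) = c'.
  pose Ej : finType := {p : C * C | ed (j, true) p.1 p.2}.
  (* Both edge colourings give [x i] its loop, so the homeomorphism can be chosen to fix [x i]. *)
  pose lp i : Ej := exist _ (mk C i, mk C i) (ed_loop C (j, true) i).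
  have [||u [lu ou eu mu]] :=
      @refine_coloring n x hx _ Ej q' (fun p => (val p).1) lp lq' oq'.
  - by move=> c; have [c' h] := ed_tot (j, true) c; exists (exist _ (c, c') h).
  - by move=> i; rewrite mq'.
  have [||v [lv ov ev mv]] :=
      @refine_coloring n x hx _ Ej q' (fun p => (val p).2) lp lq' oq'.
  - move=> c; have [c' /ed_sym h] := ed_tot (j, false) c.
    by exists (exist _ (c', c) h).
  - by move=> i; rewrite mq'.
  have [|g [sg vg]] := homogeneity hx lu lv ou ov; first by move=> i; rewrite mu mv.
  exists g; split=> // c c'; split=> [h|[z [<- <-]]].
    have [z ez] := ou (exist _ (c, c') h).
    by exists z; rewrite -eu -ev vg ez.
  by rewrite -eu -ev vg; exact: (valP (u z)).
exists t', q'; split=> //; first by move=> j; have [] := ht' j.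
by apply: realisesI => // j; have [] := ht' j.
Qed.

(** The images of the clopen fibres of [q] under the generators determine which edges occur. *)
Lemma gopen_realises A (q : Cantor -> A) :
  gopen x [set t | tuples t /\ realises t q].
Proof.
split=> [t []//|t [ht [lq oq mq hq]]].
exists #|A|, (fun i => q @^-1` [set enum_val i]); split.
  move=> i; apply: loc_clopen.
  exact: (@loc_comp _ _ _ (fun a => a = enum_val i) lq).
move=> s [hs hst]; split=> //; apply: realisesI => // j a a'.
rewrite (hq (j, true)) /act /=; have := hst j (enum_rank a).
rewrite enum_rankK => /seteqP[st ts]; split=> -[z [za za']].
  have [|y /= ya e] := ts (hfun (t j) z); first by exists z.
  by exists y; rewrite e.
have [|y /= ya e] := st (hfun (s j) z); first by exists z.
by exists y; rewrite e.
Qed.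

(** Let [u] record membership in each [cs i] and in each image of [cs i] under [t j]. If [s] has
    only colour transitions of [t], then [s j] sends [cs i] into its image under [t j], and
    complement into complement. *)
Lemma gopen_coloring U t : gopen x U -> U t ->
  exists (T : finType) (u : Cantor -> T), loc u /\ forall s, tuples s ->
    (forall j z, exists y, u y = u z /\ u (hfun (t j) y) = u (hfun (s j) z)) -> U s.
Proof.
move=> [_ oU] /oU[k [cs [ccs sU]]].
pose u z := ([ffun i => `[< cs i z >]],
  [ffun ij : 'I_k * 'I_m => `[< cs ij.1 (hinv (t ij.2) z) >]]).
exists _, u; split.
  apply: loc_pair; apply: loc_ffun; first by move=> i; exact: clopen_loc.
  move=> [i j] /=; have := continuous_loc (@hinv_cont (t j)) (clopen_loc (ccs i)).
  exact.
move=> s hs hu; apply: sU; split=> // j i.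
have h z : cs i z <-> cs i (hinv (t j) (hfun (s j) z)).
  have [y [[/ffunP/(_ i) + _] [_ /ffunP/(_ (i, j))]]] := hu j z.
  rewrite !ffunE /= hfunK => e1 e2.
  by apply: asbool_eq_equiv; rewrite -e1 e2.
apply/seteqP; split=> y [z cz <-].
  by exists (hinv (t j) (hfun (s j) z)); rewrite ?hinvK //; exact: (h z).1.
exists (hinv (s j) (hfun (t j) z)); rewrite ?hinvK //.
by apply: (h _).2; rewrite hinvK hfunK.
Qed.

Lemma realises_coloring t s A (q : Cantor -> A) T (f : A -> T) u :
  (forall z, f (q z) = u z) -> realises t q ->
  (forall j z, ed (j, true) (q z) (q (hfun (s j) z))) ->
  forall j z, exists y, u y = u z /\ u (hfun (t j) y) = u (hfun (s j) z).
Proof.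
move=> fu [_ _ _ ht] hs j z.
by have /ht[y [e1 e2]] := hs j z; exists y; rewrite -!fu e1 -e2.
Qed.

(** * A Baire category argument *)

Record approx := Approx {
  ap_struct : mstruct;
  ap_col : Cantor -> ap_struct;
  ap_tuple : 'I_m -> homeo;
  ap_tuples : tuples ap_tuple;
  ap_realises : realises ap_tuple ap_col }.

(** Small fibres with small images make the edge relations shrink to graphs. The last clause asks
    only that [s] follow edges of [b], which is all that is known of a limit tuple. *)
Definition refines_approx (N : set ('I_m -> homeo)) l (a b : approx) :=
  [/\ exists2 f : ap_struct b -> ap_struct a,
        (forall z, f (ap_col b z) = ap_col a z) & epi f,
      sep l (ap_col b),
      forall d z y, ap_col b z = ap_col b y ->
        agree l (act (ap_tuple b) d z) (act (ap_tuple b) d y) &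
      forall s, tuples s ->
        (forall j z, ed (j, true) (ap_col b z) (ap_col b (hfun (s j) z))) -> ~ N s].

Lemma approx_step N l a : gnowhere_dense x N -> exists b, refines_approx N l a b.
Proof.
case: a => A q t ht tq ndN.
have [|V [oV [t' Vt'] VU VN]] := ndN _ (gopen_realises q); first by exists t.
have [ht' t'q] := VU _ Vt'.
have [T [u [lu uV]]] := gopen_coloring oV Vt'.
(* The new partition combines [u], which confines tuples to [V], with the old [q], the level of [z]
   and the levels of all its images. *)
pose w z := [ffun d => lvl l (act t' d z)].
have lw : loc w.
  by apply: loc_ffun => d; exact: continuous_loc (@act_continuous _ t' d) (loc_lvl l).
have [lq _ _ _] := t'q.
have [B [p [f [t'p fp]]]] :=
  realises_colorings ht' (loc_pair (loc_pair lu lq) (loc_pair (loc_lvl l) lw)).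
exists (Approx ht' t'p); split=> /=.
- exists (fun b => (f b).1.2); first by move=> z; rewrite fp.
  by apply: realises_epi t'q t'p _ => z; rewrite fp.
- by move=> z y e; apply: lvl_agree; have := fp z; rewrite e fp => -[].
- move=> d z y e; apply: lvl_agree; have := fp z; rewrite e fp => -[_ _ _].
  by move=> /ffunP/(_ d); rewrite !ffunE.
- move=> s hs hp Ns; suff : (V `&` N) s by rewrite VN.
  split=> //; apply: uV => //.
  by apply: (realises_coloring (f := fun b => (f b).1.1)) t'p hp => z; rewrite fp.
Qed.

Lemma baire (N : nat -> set ('I_m -> homeo)) :
  (forall k, gnowhere_dense x (N k)) -> exists t, tuples t /\ forall k, ~ N k t.
Proof.
move=> ndN.
have cid_cont : continuous (@idfun Cantor) by move=> z.
pose h1 := Homeo cid_cont cid_cont (fun=> erefl) (fun=> erefl).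
have ht1 : tuples (fun=> h1) by [].
have [A0 [q0 [_ [r0 _]]]] := realises_colorings ht1 (loc_lvl 0).
pose nxt k a := sval (cid (approx_step k a (ndN k))).
have nxtP k a : refines_approx (N k) k a (nxt k a).
  exact: (svalP (cid (approx_step k a (ndN k)))).
pose S := fix S k := if k is k'.+1 then nxt k' (S k') else Approx ht1 r0.
(* The tuples of successive approximations are unrelated; the limit is taken of the nested edge
   relations instead. *)
pose R d k z y : Prop := ed d (ap_col (S k) z) (ap_col (S k) y).
have Rsmall d l z z' y y' : ap_col (S l.+1) z = ap_col (S l.+1) z' ->
    R d l.+1 z y -> R d l.+1 z' y' -> agree l y y'.
  have [_ sp st _] := nxtP l (S l); rewrite /R /=.
  have [_ _ _ hr] := ap_realises (nxt l (S l)).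
  move=> e /hr[w [wz wy]] /hr[w' [wz' wy']].
  apply: agree_trans (agree_sym (sp _ _ wy)) _; apply: agree_trans (sp _ _ wy').
  by apply: st; rewrite wz wz'.
have Rloc d k z : loc (R d k z).
  have [lq _ _ _] := ap_realises (S k).
  exact: (@loc_comp _ _ _ (fun a => ed d (ap_col (S k) z) a : Prop) lq).
have Rsym d k z y : R d k z y = R (dinv d) k y z.
  by rewrite /R; have [-> _ _] := mvalid (ap_struct (S k)).
have Rtot d k z : exists y, R d k z y.
  have [_ oq _ _] := ap_realises (S k).
  have [a ha] := ed_tot d (ap_col (S k) z); have [y ya] := oq a.
  by exists y; rewrite /R ya.
have /choice[t ht] (j : 'I_m) : exists g, stab x g /\
    forall k z, R (j, true) k z (hfun g z).
  have [|||||||g [Rg ug]] := @limit_homeo (R (j, true)).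
  - move=> k z y; rewrite /R /=.
    by have [[f fq [fe _ _ _]] _ _ _] := nxtP k (S k); rewrite -!fq => /fe.
  - exact: Rtot.
  - by move=> k y; have [z h] := Rtot (j, false) k y; exists z; rewrite Rsym.
  - exact: Rloc.
  - move=> k y; have [l hl] := Rloc (j, false) k y; exists l => z z' /hl e.
    by rewrite !(Rsym (j, true)).
  - move=> l; exists l.+1; have [[k' hk'] _ _ _] := ap_realises (S l.+1).
    by exists k' => z z' y y' /hk'; exact: Rsmall.
  - move=> l; exists l.+1; have [[k' hk'] _ _ _] := ap_realises (S l.+1).
    exists k' => z z' y y' /hk'; rewrite !(Rsym (j, true)); exact: Rsmall.
  exists g; split=> // i; apply: ug => k; rewrite /R.
  by have [_ _ -> _] := ap_realises (S k); exact: ed_loop.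
have tt : tuples t by move=> j; have [] := ht j.
exists t; split=> // k; have [_ _ _ h] := nxtP k (S k).
by apply: h => // j z; have [_ /(_ k.+1 z)] := ht j.
Qed.

(** * Generic tuples *)

Definition extensible t A C (phi : C -> A) (q : Cantor -> A) :=
  exists2 q' : Cantor -> C, realises t q' & forall z, phi (q' z) = q z.

Definition finely_good t := forall k, exists A (q : Cantor -> A),
  [/\ good A, realises t q & sep k q].

Definition saturated t := forall A C (phi : C -> A) (q : Cantor -> A),
  good A -> epi phi -> realises t q -> extensible t phi q.

Lemma coloring_mem U t s T (u : Cantor -> T) A (q : Cantor -> A) (f : A -> T) :
  (forall s, tuples s ->
    (forall j z, exists y, u y = u z /\ u (hfun (t j) y) = u (hfun (s j) z)) -> U s) ->
  (forall z, f (q z) = u z) -> realises t q -> realises s q -> tuples s -> U s.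
Proof.
move=> hU fq tq sq hs; apply: hU => //; apply: realises_coloring fq tq _ => j z.
exact: (realises_ed (j, true) z sq).
Qed.

(** Inside any nonempty open set, a tuple realises a fine partition whose structure can be replaced
    by its unfolding. *)
Lemma nowhere_dense_not_finely_good k : gnowhere_dense x
  [set t | ~ exists A (q : Cantor -> A), [/\ good A, realises t q & sep k q]].
Proof.
move=> U oU [t Ut].
have [T [u [lu uU]]] := gopen_coloring oU Ut.
have ht : tuples t by case: oU => h _; exact: h.
have [A [q [f [tq fq]]]] := realises_colorings ht (loc_pair lu (loc_lvl k)).
have [t' [q' [ht' tq' eq']]] := realise_extension tq (unfolding_epi A).
exists [set s | tuples s /\ realises s q']; split.
- exact: gopen_realises.
- by exists t'.
- move=> s [hs sq']; apply: (coloring_mem uU (f := fst \o f) _ tq) => //.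
    by move=> z /=; rewrite fq.
  have -> : q = @uproj _ _ A \o q' by apply/funext => z; rewrite /= eq'.
  exact: realises_comp sq' (unfolding_epi A).
- apply/seteqP; split=> // s [[hs sq']]; apply.
  exists (unfolding A), q'; split=> //; first exact: good_unfolding.
  move=> z y e; apply: lvl_agree; have := fq z.
  by rewrite -eq' e eq' fq => -[].
Qed.

Lemma nowhere_dense_not_extensible A C (phi : C -> A) (q : Cantor -> A) :
  gnowhere_dense x [set t | [/\ good A, epi phi, realises t q & ~ extensible t phi q]].
Proof.
move=> U oU U0.
have [[t [Ut [gA ephi tq]]]|nU] := pselect (exists t, U t /\
    [/\ good A, epi phi & realises t q]); last first.
  exists U; split=> //; apply/seteqP; split=> // t [Ut [gA ephi tq _]].
  by apply: nU; exists t.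
have [T [u [lu uU]]] := gopen_coloring oU Ut.
have ht : tuples t by case: oU => h _; exact: h.
have [lq _ _ _] := tq.
have [D [p [f [tp fp]]]] := realises_colorings ht (loc_pair lu lq).
have epsi : epi (snd \o f) by apply: realises_epi tq tp _ => z /=; rewrite fp.
(* Realising the amalgam [E] keeps tuples in [U] through [D] and extends [q] through [C]. *)
have [E [f1 [g1 [ef1 eg1 fg]]]] := gA _ _ _ _ ephi epsi.
have [t' [e [ht' te eg]]] := realise_extension tp eg1.
exists [set s | tuples s /\ realises s e]; split.
- exact: gopen_realises.
- by exists t'.
- move=> s [hs se]; apply: (coloring_mem uU (f := fst \o f) _ tp) => //.
    by move=> z /=; rewrite fp.
  have -> : p = g1 \o e by apply/funext => z; rewrite /= eg.
  exact: realises_comp se eg1.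
- apply/seteqP; split=> // s [[hs se] [_ _ _]]; apply.
  exists (f1 \o e); first exact: realises_comp se ef1.
  by move=> z /=; rewrite fg /= eg fp.
Qed.

(** * Countably many conditions for genericity *)

Definition scode :=
  {r : nat & ({ffun dir m * 'I_r * 'I_r -> bool} * {ffun 'I_n -> 'I_r})%type}.

(* Codes that do not describe a structure are sent to [mpoint]. *)
Definition sdecode (c : scode) : mstruct :=
  if pselect (@valid n m 'I_(tag c) (fun d a b => (tagged c).1 (d, a, b)) (tagged c).2)
  is left v then MStruct v else mpoint n m.

Lemma sdecode_onto A : exists c (f : A -> sdecode c) (g : sdecode c -> A),
  [/\ cancel f g, epi f & epi g].
Proof.
pose e d (a b : 'I_#|A|) := ed d (enum_val a) (enum_val b).
pose p i := enum_rank (mk A i).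
have v : @valid n m 'I_#|A| e p.
  split=> [d a b|d a|d i]; rewrite /e.
  - by have [<- _ _] := mvalid A.
  - by have [b h] := ed_tot d (enum_val a); exists (enum_rank b); rewrite enum_rankK.
  - by rewrite enum_rankK; exact: ed_loop.
pose c : scode := @Tagged nat #|A|
  (fun r => {ffun dir m * 'I_r * 'I_r -> bool} * {ffun 'I_n -> 'I_r})%type
  ([ffun k => e k.1.1 k.1.2 k.2], [ffun i => p i]).
exists c; rewrite /sdecode; case: pselect => [w|[]] /=; last first.
  case: v => v1 v2 v3; split=> [d a b|d a|d i]; rewrite /= ?ffunE //=.
  by have [b h] := v2 d a; exists b; rewrite /= ffunE.
exists (@enum_rank A), (@enum_val A xpredT); split; first exact: enum_rankK.
- split=> /=.
  + by move=> d a b h; rewrite ffunE /e /= !enum_rankK.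
  + by move=> i; exists (enum_val i); rewrite enum_valK.
  + move=> d a b; rewrite ffunE => h; exists (enum_val a), (enum_val b).
    by rewrite !enum_valK.
  + by move=> i; rewrite ffunE.
- split=> /=.
  + by move=> d a b; rewrite ffunE.
  + by move=> a; exists (enum_rank a); rewrite enum_rankK.
  + move=> d a b h; exists (enum_rank a), (enum_rank b).
    by rewrite ffunE /e /= !enum_rankK.
  + by move=> i; rewrite ffunE enum_rankK.
Qed.

(** A colouring is locally constant, so it is coded by a map on words of some length [l]; the code
    type is countable. *)
Definition ext_code :=
  {cA : scode & {cC : scode & ({ffun sdecode cC -> sdecode cA} *
    {l : nat & {ffun {ffun 'I_l -> bool} -> sdecode cA}})%type}}.

Definition nongeneric (c : (nat + ext_code)%type) : set ('I_m -> homeo) :=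
  match c with
  | inl k => [set t | ~ exists A (q : Cantor -> A), [/\ good A, realises t q & sep k q]]
  | inr (existT cA (existT cC (phi, existT l f))) =>
      [set t | let q := fun z => f (lvl l z) in
       [/\ good (sdecode cA), epi phi, realises t q & ~ extensible t phi q]]
  end.

Lemma nowhere_dense_nongeneric c : gnowhere_dense x (nongeneric c).
Proof.
case: c => [k|[cA [cC [phi [l f]]]]]; first exact: nowhere_dense_not_finely_good.
exact: nowhere_dense_not_extensible.
Qed.

Lemma good_iso A B (f : A -> B) (g : B -> A) :
  cancel g f -> epi f -> epi g -> good A -> good B.
Proof.
move=> gK ef eg gA C D phi psi ephi epsi.
have [E [f1 [g1 [ef1 eg1 h]]]] := gA _ _ _ _ (epi_comp eg ephi) (epi_comp eg epsi).
by exists E, f1, g1; split=> // e; apply: (can_inj gK); exact: h.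
Qed.

Lemma generic_saturated t : (forall c, ~ nongeneric c t) -> saturated t.
Proof.
move=> ht A C phi q gA ephi tq; apply: contrapT => nex.
have [cA [fA [gA' [fAK efA egA]]]] := sdecode_onto A.
have [cC [fC [gC [fCK efC egC]]]] := sdecode_onto C.
have tfq := realises_comp tq efA.
have [l hl] : loc (fA \o q) by case: tfq.
(* Padding with [false] is a section of [lvl l]. *)
pose ext (w : {ffun 'I_l -> bool}) : Cantor :=
  fun i => if insub i is Some j then w j else false.
have extK z : agree l (ext (lvl l z)) z.
  by move=> i il; rewrite /ext insubT ffunE.
pose f := [ffun w => fA (q (ext w))].
have fE : (fun z => f (lvl l z)) = fA \o q.
  by apply/funext => z; rewrite ffunE; apply: (hl (ext _)); exact: extK.
pose ph := [ffun c => fA (phi (gC c))].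
have phE : (ph : _ -> _) = fA \o (phi \o gC) by apply/funext => c; rewrite ffunE.
have gAK : cancel gA' fA.
  have [_ o _ _] := efA; by move=> b; have [a <-] := o b; rewrite fAK.
apply: (ht (inr (existT _ cA (existT _ cC (ph, existT _ l f))))).
rewrite /= fE phE; split=> //.
- exact: good_iso gAK efA egA gA.
- exact: epi_comp efA (epi_comp ephi egC).
- move=> [q' tq' eq']; apply: nex; exists (gC \o q'); first exact: realises_comp.
  by move=> z; apply: (can_inj fAK); exact: eq'.
Qed.

(** * Conjugacy of generic tuples *)

(** Back-and-forth ranges over bare finite types, so the common structure [A] is hidden in the
    constructor. *)
Variant good_pair t s : forall E : finType, (Cantor -> E) -> (Cantor -> E) -> Prop :=
  GoodPair A (u v : Cantor -> A) of good A & realises t u & realises s v :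
    good_pair t s u v.

Lemma good_pair_sym t s (E : finType) (u v : Cantor -> E) :
  good_pair t s u v -> good_pair s t v u.
Proof. by case=> A u' v' gA tu sv; exact: GoodPair. Qed.

(** A fine good partition for [t] refines [u] and so maps onto [A]; saturation of [s] realises the
    same structure above [v]. *)
Lemma good_pair_forth t s : finely_good t -> saturated s ->
  forall (E : finType) (u v : Cantor -> E) l, good_pair t s u v ->
  exists (E' : finType) u' v' (f : E' -> E), [/\ good_pair t s u' v',
    forall z, f (u' z) = u z, forall z, f (v' z) = v z & sep l u'].
Proof.
move=> ft ss E u v l [A {}u {}v gA tu sv].
have [[k hk] ou _ _] := tu.
have [C [p [gC tp sp]]] := ft (maxn k l).
have [_ op _ _] := tp; have /choice[r hr] := op.
pose phi c := u (r c).
have phE z : phi (p z) = u z.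
  by apply: hk; apply: agree_le (leq_maxl k l) _; apply: sp; rewrite hr.
have ephi := realises_epi tu tp phE.
have [v' sv' ev'] := ss _ _ _ _ gA ephi sv.
exists C, p, v', phi; split=> //.
by move=> z y /sp; apply: agree_le; exact: leq_maxr.
Qed.

Lemma generic_conjugate t s : tuples t -> tuples s ->
  finely_good t -> saturated t -> finely_good s -> saturated s ->
  conj_orbit x t s.
Proof.
move=> ht hs ft st fs ss.
have pt_real r : tuples r -> realises r (fun=> tt : mpoint n m).
  move=> _; split=> //; first by exists 0.
  - by case; exists (fun=> false).
  - by move=> d [] []; split=> // _; exists (fun=> false).
(* The order is [s], then [t]: the conjugator must carry [s] to [t]. *)
have P0 := GoodPair (@good_mpoint n m) (pt_real s hs) (pt_real t ht).
have [| | |g [sg _ gP]] := @back_and_forth n x (good_pair s t) _ _ _ _ _ _ P0.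
- move=> E u v [A {}u {}v _ [lu ou mu _] [lv ov mv _]].
  by split=> // i; rewrite mu mv.
- exact: good_pair_forth.
- move=> E u v l /good_pair_sym/(good_pair_forth ft ss l)[E' [u' [v' [f [p h1 h2 h3]]]]].
  by exists E', v', u', f; split=> //; exact: good_pair_sym.
exists g; split=> // j y; apply: (can_inj (@hfunK g)); rewrite hinvK.
apply: agree_eq => l.
have [k hk] := continuous_loc (@hfun_cont (t j)) (loc_lvl l).
have [E [u [v [p]]]] := gP (maxn k l).
case: p => A {}u {}v _ su [_ _ _ tv] gv sv.
(* The edge traced by [s j] at [y] is also traced by [t j] at some [w]. Fineness of [v] puts [w]
   near [hfun g y], and its image near the [g]-image of [hfun (s j) y]. *)
have /tv[w [wz wy]] := realises_ed (j, true) y su.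
rewrite -gv in wz; rewrite -gv in wy.
apply: agree_trans (_ : agree l (hfun (t j) w) _).
  by apply: agree_sym; apply: agree_le (leq_maxr k l) _; exact: sv.
by apply/lvl_agree/hk; apply: agree_le (leq_maxl k l) _; exact: sv.
Qed.

End Realisation.

Theorem theorem1p2 (n : nat) (x : 'I_n -> Cantor) (hx : injective x) :
  ample_generics x.
Proof.
move=> m.
pose N k := if unpickle k is Some c then nongeneric x c else set0 : set ('I_m -> homeo).
have NP t : (forall k, ~ N k t) -> forall c, ~ nongeneric x c t.
  by move=> h c; have := h (pickle c); rewrite /N pickleK.
have ndN k : gnowhere_dense x (N k).
  rewrite /N; case: unpickle => [c|]; first exact: nowhere_dense_nongeneric.
  by move=> U oU U0; exists U; split=> //; exact: setI0.
have fine t : (forall c, ~ nongeneric x c t) -> finely_good x t.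
  by move=> h k; apply: contrapT; exact: (h (inl k)).
(* The same sets [N] provide the tuple [t] and witness that its orbit is comeagre. *)
have [t [ht /NP gt]] := baire ndN.
exists t; split=> //; exists N; split=> // s [hs nconj].
apply: contrapT => nN; apply: nconj.
have gs : forall c, ~ nongeneric x c s by apply: NP => k Nk; apply: nN; exists k.
by apply: generic_conjugate => //; (apply: fine || apply: generic_saturated).
Qed.
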